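(* Let $L$ be a bounded lattice, $\mathrm{V}$ a join-dense set of elements of $L$, and $\Lambda$ a meet-dense set of elements of $L$. For a set $P$ of pairs of elements of $L$, define $\vartriangleleft$ on $P$ by $(a,b)\vartriangleleft(c,d)$ iff $c\not\le b$. (1) If $\neg$ is a precomplementation on $L$, then with $P=\{(a,\neg a)\mid a\in L\}\cup\{(1,b)\mid b\in\Lambda\}$, there is a complete embedding of $(L,\neg)$ into $(\mathfrak{L}(P,\vartriangleleft),\neg_\vartriangleleft)$. (2) If $\neg$ is a protocomplementation on $L$, then with $P=\{(a,\neg a)\mid a\in L, a\ne0\}\cup\{(1,b)\mid b\in\Lambda, b\ne1\}$, there is a complete embedding of $(L,\neg)$ into $(\mathfrak{L}(P,\vartriangleleft),\neg_\vartriangleleft)$, and $\vartriangleleft$ is reflexive. (3) If $\neg$ is an ultraweak pseudocomplementation on $L$, then with $P=\{(a,\neg a)\mid a\in\mathrm{V}\}\cup\{(1,b)\mid b\in\Lambda\}$, there is a complete embedding of $(L,\neg)$ into $(\mathfrak{L}(P,\vartriangleleft),\neg_\vartriangleleft)$, and $\vartriangleleft$ is pseudosymmetric (and strongly pseudosymmetric if $\mathrm{V}=L$). (4) If $\neg$ is a weak pseudocomplementation on $L$, then with $P=\{(a,\neg a)\mid a\in\mathrm{V}, a\ne0\}\cup\{(1,b)\mid b\in\Lambda, b\ne1\}$, there is a complete embedding of $(L,\neg)$ into $(\mathfrak{L}(P,\vartriangleleft),\neg_\vartriangleleft)$, and $\vartriangleleft$ is reflexive and pseudosymmetric (and strongly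 pseudosymmetric if $\mathrm{V}=L$). Moreover, if $\neg$ is a pseudocomplementation, then $\vartriangleleft$ is weakly compossible. In each case, if $L$ is complete, then the embedding is an isomorphism.
   Context: A set $S\subseteq L$ is join-dense (resp. meet-dense) if every element of $L$ is the join (resp. meet) of some subset of $S$. Negation types on a bounded lattice: a precomplementation is an antitone ($a\le b\Rightarrow\neg b\le\neg a$) unary operation with $\neg1=0$; a protocomplementation is antitone with $a\wedge\neg a=0$ for all $a$ and $\neg0=1$; an ultraweak pseudocomplementation is antitone with $a\le\neg\neg a$ for all $a$ and $\neg1=0$; a weak pseudocomplementation is antitone with $a\wedge\neg a=0$ and $a\le\neg\neg a$ for all $a$; a pseudocomplementation sends each $a$ to the maximum of $\{y\mid a\wedge y=0\}$. For a nonempty set $X$ with binary relation $\vartriangleleft$ (write $y\vartriangleright x$ for $x\vartriangleleft y$): $c_\vartriangleleft(A)=\{x\mid\forall x'\vartriangleleft x\ \exists x''\vartriangleright x':x''\in A\}$; $\mathfrak{L}(X,\vartriangleleft)$ is the complete lattice of sets $A$ with $c_\vartriangleleft(A)=A$ ordered by inclusion (meets are intersections, joins are $c_\vartriangleleft$ of unions); $\neg_\vartriangleleft A=\{x\mid\forall y\vartriangleleft x,\ y\notin A\}$. $x$ is absurd if no $y$ satisfies $y\vartriangleleft x$. $x$ pre-refines $y$ if $z\vartriangleleft x$ implies $z\vartriangleleft y$ for all $z$. $\vartriangleleft$ is pseudosymmetric if for all $x$ and $y\vartriangleleft x$ there is $z\vartriangleleft y$ pre-refining $x$; strongly pseudosymmetric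 if for all $x$ and $y\vartriangleleft x$ there is $z\vartriangleleft y$ such that $z$ pre-refines $x$ and $x$ pre-refines $z$; weakly compossible if for all $x$ and $y\vartriangleleft x$ there is a non-absurd $z$ pre-refining both $y$ and $x$. A complete embedding of $(L,\neg)$ into $(L',\neg')$ is an injective map preserving all existing meets and joins of $L$ and commuting with negation. *)

(* Defs.v *)
From HB Require Import structures.
From Stdlib Require RelationClasses.
From mathcomp Require Export all_boot all_order.
From mathcomp Require Export boolp classical_sets.

Set Implicit Arguments.
Unset Strict Implicit.
Unset Printing Implicit Defensive.

Import Order.TTheory.

Local Open Scope classical_set_scope.
Local Open Scope order_scope.

Section Lattices.
Context {d : Order.disp_t} {L : tbLatticeType d}.
Implicit Types (S : set L) (neg : L -> L).

Definition join_dense S :=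
  forall a : L, exists2 T : set L, T `<=` S & supremums T a.

Definition meet_dense S :=
  forall a : L, exists2 T : set L, T `<=` S & infimums T a.

Definition antitone neg := forall a b : L, a <= b -> neg b <= neg a.

Definition precomplementation neg := antitone neg /\ neg \top = \bot.

Definition protocomplementation neg :=
  [/\ antitone neg, forall a, Order.meet a (neg a) = \bot & neg \bot = \top].

Definition ultraweak_pseudocomplementation neg :=
  [/\ antitone neg, forall a, a <= neg (neg a) & neg \top = \bot].

Definition weak_pseudocomplementation neg :=
  [/\ antitone neg, forall a, Order.meet a (neg a) = \bot
    & forall a, a <= neg (neg a)].

Definition pseudocomplementation neg :=
  forall a, let Y := [set y | Order.meet a y = \bot] in
    Y (neg a) /\ ubound Y (neg a).

End Lattices.

Definition complete_lattice {d} (L : tbLatticeType d) :=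
  forall S : set L, supremums S !=set0 /\ infimums S !=set0.

Section Maps.
Context {d d' : Order.disp_t} {L : tbLatticeType d} {L' : tbLatticeType d'}.
Implicit Types (neg : L -> L) (f : L -> L').

Definition complete_embedding neg (neg' : L' -> L') f :=
  [/\ injective f,
      forall (S : set L) s, supremums S s -> supremums (f @` S) (f s),
      forall (S : set L) s, infimums S s -> infimums (f @` S) (f s)
    & forall a, f (neg a) = neg' (f a)].

Definition lattice_isomorphism neg (neg' : L' -> L') f :=
  [/\ bijective f, forall a b, (f a <= f b) = (a <= b)
    & forall a, f (neg a) = neg' (f a)].

End Maps.

(* Throughout, [R y x] stands for y ◁ x. *)
Section Relations.
Context {X : Type} (R : X -> X -> Prop).
Implicit Types (A B : set X) (x y z : X).

Definition rclosure A : set X :=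
  [set x | forall x', R x' x -> exists2 x'', R x' x'' & A x''].

Definition rneg A : set X := [set x | forall y, R y x -> ~ A y].

Definition absurd_point x := ~ exists y, R y x.

Definition pre_refines x y := forall z, R z x -> R z y.

Definition pseudosymmetric :=
  forall x y, R y x -> exists2 z, R z y & pre_refines z x.

Definition strongly_pseudosymmetric :=
  forall x y, R y x ->
    exists z, [/\ R z y, pre_refines z x & pre_refines x z].

Definition weakly_compossible :=
  forall x y, R y x ->
    exists z, [/\ ~ absurd_point z, pre_refines z y & pre_refines z x].

Lemma sub_rclosure A : A `<=` rclosure A.
Proof. by move=> x Ax y yx; exists x. Qed.

Lemma rclosureS A B : A `<=` B -> rclosure A `<=` rclosure B.
Proof. by move=> AB x cx y /cx[z yz Az]; exists z => //; exact: AB. Qed.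

Lemma rclosure_idem A : rclosure (rclosure A) = rclosure A.
Proof.
apply/seteqP; split; last exact: sub_rclosure.
by move=> x cx y /cx[z yz]; apply.
Qed.

Lemma rclosure_rneg A : rclosure (rneg A) = rneg A.
Proof.
apply/seteqP; split; last exact: sub_rclosure.
by move=> x cx y /cx[z yz]; apply.
Qed.

Lemma rclosureI A B : rclosure A = A -> rclosure B = B ->
  rclosure (A `&` B) = A `&` B.
Proof.
move=> cA cB; apply/seteqP; split; last exact: sub_rclosure.
by move=> x cx; split; [rewrite -cA|rewrite -cB];
  apply: rclosureS cx => ? [].
Qed.

Lemma rclosureT : rclosure setT = setT.
Proof. by apply/seteqP; split=> // x _; exact: sub_rclosure. Qed.

(* 𝔏(X, ◁) *)
Record fixlat := Fixlat {
  fixset :> set X;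
  fixsetP : `[< rclosure fixset = fixset >] }.

End Relations.

Section FixlatOrder.
Context {X : Type} {R : X -> X -> Prop}.
Implicit Types A B C : fixlat R.

HB.instance Definition _ := [isSub for @fixset X R].
HB.instance Definition _ := [Choice of fixlat R by <:].

Lemma fixsetE A : rclosure R A = A.
Proof. exact/asboolP/fixsetP. Qed.

Definition fixlat_of (A : set X) (cA : rclosure R A = A) : fixlat R :=
  Fixlat (asboolT cA).

Definition fixneg A : fixlat R := fixlat_of (rclosure_rneg R A).

Definition fix_le A B := `[< fixset A `<=` fixset B >].

Fact fix_le_refl : reflexive fix_le.
Proof. by move=> A; apply/asboolP. Qed.

Fact fix_le_anti : antisymmetric fix_le.
Proof.
by move=> A B /andP[/asboolP AB /asboolP BA]; apply/val_inj/seteqP.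
Qed.

Fact fix_le_trans : transitive fix_le.
Proof.
by move=> A B C /asboolP BA /asboolP AC; apply/asboolP/(subset_trans BA).
Qed.

HB.instance Definition _ := Order.Le_isPOrder.Build set_display (fixlat R)
  fix_le_refl fix_le_anti fix_le_trans.

Lemma fixlat_leP A B : reflect (fixset A `<=` fixset B) (A <= B).
Proof. exact: asboolP. Qed.

Definition fix_meet A B : fixlat R :=
  fixlat_of (rclosureI (fixsetE A) (fixsetE B)).

Definition fix_join A B : fixlat R :=
  fixlat_of (rclosure_idem R (fixset A `|` fixset B)).

Fact fix_meetP A B C : (A <= fix_meet B C) = (A <= B) && (A <= C).
Proof.
apply/fixlat_leP/andP => [AI|[/fixlat_leP AB /fixlat_leP AC] x Ax].
  by split; apply/fixlat_leP => x /AI[].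
by split; [exact: AB|exact: AC].
Qed.

Fact fix_joinP A B C : (fix_join A B <= C) = (A <= C) && (B <= C).
Proof.
apply/fixlat_leP/andP => [JC|[/fixlat_leP AC /fixlat_leP BC] x].
  by split; apply/fixlat_leP => x ?; apply/JC/sub_rclosure; [left|right].
by rewrite -(fixsetE C); apply: rclosureS => y [/AC|/BC].
Qed.

HB.instance Definition _ := Order.POrder_MeetJoin_isLattice.Build
  set_display (fixlat R) fix_meetP fix_joinP.

Fact fix_bot_le A : fixlat_of (rclosure_idem R set0) <= A.
Proof.
by apply/fixlat_leP; rewrite -(fixsetE A); exact: rclosureS.
Qed.

Fact fix_le_top A : A <= fixlat_of (rclosureT R).
Proof. exact/fixlat_leP. Qed.

HB.instance Definition _ :=
  Order.hasBottom.Build set_display (fixlat R) fix_bot_le.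
HB.instance Definition _ :=
  Order.hasTop.Build set_display (fixlat R) fix_le_top.

Lemma fixlat_supremum (F : set (fixlat R)) :
  supremums F (fixlat_of (rclosure_idem R (\bigcup_(A in F) fixset A))).
Proof.
split=> [A FA|B uB].
  by apply/fixlat_leP => x Ax; apply: sub_rclosure; exists A.
apply/fixlat_leP; rewrite -(fixsetE B); apply: rclosureS => x [A FA].
exact/fixlat_leP/uB.
Qed.

Lemma rclosure_bigcap (F : set (fixlat R)) :
  rclosure R (\bigcap_(A in F) fixset A) = \bigcap_(A in F) fixset A.
Proof.
apply/seteqP; split; last exact: sub_rclosure.
by move=> x cx A FA; rewrite -fixsetE; apply: rclosureS cx => y; apply.
Qed.

Lemma fixlat_infimum (F : set (fixlat R)) :
  infimums F (fixlat_of (rclosure_bigcap F)).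
Proof.
split=> [A FA|B lB]; apply/fixlat_leP => x; first exact.
by move=> Bx A FA; move: x Bx; apply/fixlat_leP/lB.
Qed.

End FixlatOrder.

Lemma fixlat_complete (X : Type) (R : X -> X -> Prop) :
  complete_lattice (fixlat R).
Proof.
by move=> F; split; eexists; [exact: fixlat_supremum|exact: fixlat_infimum].
Qed.

(* (a, b) ◁ (c, d) iff c is not below b, on the pairs belonging to P *)
Definition pair_rel {d} {L : tbLatticeType d} (P : set (L * L)) :
    set_type P -> set_type P -> Prop :=
  fun x y => ~ ((val y).1 <= (val x).2).

(* Main.v *)
(* The embedding sends [a] to the set of pairs of [P] whose first component is
   below [a].  Such a set is closed because the second components of [P] are
   meet-dense; the map reflects the order and preserves joins because the first
   components are join-dense; and it commutes with negation as soon as [neg] is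
   recovered from [P] by [c <= neg a] iff [c <= y.2] for every [y] in [P] with
   [y.1 <= a].  When [a <= neg (neg a)], [neg] is a self-adjoint Galois
   connection, so [(v, neg v)] precedes [x] as soon as [v] is not below [x.2]:
   this provides the pseudosymmetric witnesses. *)
Require Import Defs.

Set Implicit Arguments.
Unset Strict Implicit.
Unset Printing Implicit Defensive.

Import Order.TTheory.

Local Open Scope classical_set_scope.
Local Open Scope order_scope.

(** * Density and tests for inequalities *)

Section Density.
Context {d : Order.disp_t} {L : tbLatticeType d}.
Implicit Types (S : set L) (a b : L).

(** Bottom contributes nothing to a join, and dually top to a meet, so density survives their
    removal from the components of [P]. *)
Lemma join_dense_sub S S' : join_dense S ->
  (forall s, S s -> s <> \bot -> S' s) -> join_dense S'.
Proof.
move=> dS SS' a; have [T TS [ubT lubT]] := dS a.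
exists (T `&` [set s | s <> \bot]) => [s [/TS/SS']|]; first exact.
split=> [s []|b ubb]; first by move/ubT.
apply: lubT => s Ts; have [->|/eqP s0] := eqVneq s \bot; first exact: le0x.
exact: ubb.
Qed.

Lemma meet_dense_sub S S' : meet_dense S ->
  (forall s, S s -> s <> \top -> S' s) -> meet_dense S'.
Proof.
move=> dS SS' a; have [T TS [lbT glbT]] := dS a.
exists (T `&` [set s | s <> \top]) => [s [/TS/SS']|]; first exact.
split=> [s []|b lbb]; first by move/lbT.
apply: glbT => s Ts; have [->|/eqP s1] := eqVneq s \top; first exact: lex1.
exact: lbb.
Qed.

Lemma join_denseT : join_dense [set: L].
Proof. by move=> a; exists [set a] => //; split=> [s ->|b]; last exact. Qed.

Lemma join_dense_le S a b : join_dense S ->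
  (forall s, S s -> s <= a -> s <= b) -> a <= b.
Proof.
move=> dS Sab; have [T TS [ubT lubT]] := dS a.
by apply: lubT => s Ts; apply: Sab; [exact: TS|exact: ubT].
Qed.

Lemma meet_dense_le S a b : meet_dense S ->
  (forall s, S s -> b <= s -> a <= s) -> a <= b.
Proof.
move=> dS Sab; have [T TS [lbT glbT]] := dS b.
by apply: glbT => s Ts; apply: Sab; [exact: TS|exact: lbT].
Qed.

Lemma join_dense_nle S a b : join_dense S -> ~ a <= b ->
  exists s, [/\ S s, s <= a & ~ s <= b].
Proof.
move=> dS nab; apply: contra_notP nab => nS.
apply: (join_dense_le dS) => s Ss sa.
by apply: contra_notP nS => nsb; exists s.
Qed.

End Density.

Definition set_point {T : Type} {P : set T} {p : T} (Pp : P p) :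
    set_type P :=
  exist _ p (mem_set Pp).

(** * The embedding into closed sets of pairs *)

Section PairRepresentation.
Context {d : Order.disp_t} {L : tbLatticeType d} (P : set (L * L)).
Hypotheses (fstP : join_dense (fst @` P)) (sndP : meet_dense (snd @` P)).

Let R := @pair_rel d L P.

Definition pairs_below (a : L) : set (set_type P) := [set x | (val x).1 <= a].

Lemma rclosure_pairs_below a : rclosure R (pairs_below a) = pairs_below a.
Proof.
apply/seteqP; split; last exact: sub_rclosure.
move=> x cx; apply: (meet_dense_le sndP) => _ [p Pp <-] ap.
apply: contrapT => nxp.
(* By [nxp], [p] precedes [x], so closure yields [y] with [y.1 <= a] and [p] preceding [y]; but
   [a <= p.2]. *)
have [y nyp ya] := cx (set_point Pp) nxp.
exact/nyp/(le_trans ya).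
Qed.

Definition pairs_embed a : fixlat R := fixlat_of (rclosure_pairs_below a).

Lemma pairs_embed_le a b : (pairs_embed a <= pairs_embed b) = (a <= b).
Proof.
apply/fixlat_leP/idP => [ab|ab x xa]; last exact: le_trans xa ab.
apply: (join_dense_le fstP) => _ [p Pp <-].
exact: (ab (set_point Pp)).
Qed.

Lemma pairs_embed_inj : injective pairs_embed.
Proof. by move=> a b ab; apply/le_anti; rewrite -!pairs_embed_le ab lexx. Qed.

Lemma pairs_embed_sup (S : set L) s :
  supremums S s -> supremums (pairs_embed @` S) (pairs_embed s).
Proof.
move=> [ubS lubS]; split=> [_ [a Sa <-]|B ubB].
  by rewrite pairs_embed_le; exact: ubS.
apply/fixlat_leP => x xs; rewrite -fixsetE => y yx.
(* If [y.2] bounded [S], it would bound [s] and hence [x.1]. Join-density then shrinks [a] to the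
   first component of a pair that [y] still precedes. *)
have [a Sa nay] : exists2 a, S a & ~ a <= (val y).2.
  apply: contra_notP yx => nS; apply: le_trans xs _; apply: lubS => a Sa.
  by apply: contra_notP nS => ?; exists a.
have [_ [[p Pp <-] pa npy]] := join_dense_nle fstP nay.
exists (set_point Pp) => //.
have /fixlat_leP : pairs_embed a <= B by apply: ubB; exists a.
exact.
Qed.

Lemma pairs_embed_inf (S : set L) s :
  infimums S s -> infimums (pairs_embed @` S) (pairs_embed s).
Proof.
move=> [lbS glbS]; split=> [_ [a Sa <-]|B lbB].
  by rewrite pairs_embed_le; exact: lbS.
apply/fixlat_leP => x Bx; apply: glbS => a Sa.
have /fixlat_leP : B <= pairs_embed a by apply: lbB; exists a.
exact.
Qed.

(** The preimage of [B] is the join [s] of its first components: if [y] precedes some [x] with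
    [x.1 <= s], then [y.2] cannot bound all of them, so [y] precedes a member of [B]. *)
Lemma pairs_embed_surj : complete_lattice L ->
  forall B : fixlat R, exists a, pairs_embed a = B.
Proof.
move=> cL B.
have [[s [ubs lubs]] _] := cL [set (val x).1 | x in fixset B].
exists s; apply/le_anti/andP; split; apply/fixlat_leP => x; last first.
  by move=> Bx; apply: ubs; exists x.
move=> xs; rewrite -fixsetE => y yx; apply: contra_notP yx => nB.
apply: le_trans xs _; apply: lubs => _ [z Bz <-].
by apply: contra_notP nB => ?; exists z.
Qed.

Lemma pairs_embed_bij : complete_lattice L -> bijective pairs_embed.
Proof.
move=> /pairs_embed_surj /choice[g gK].
by exists g => // a; apply: pairs_embed_inj.
Qed.

Lemma pair_representation (neg : L -> L) :
  (forall a c, c <= neg a <-> forall y, P y -> y.1 <= a -> c <= y.2) ->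
  exists f : L -> fixlat R,
    complete_embedding neg fixneg f /\
    (complete_lattice L -> lattice_isomorphism neg fixneg f).
Proof.
move=> negE.
(* At [c = x.1], the right side of [negE] says that no [y] preceding [x] has [y.1 <= a]. *)
have fneg a : pairs_embed (neg a) = fixneg (pairs_embed a).
  apply/le_anti/andP; split; apply/fixlat_leP => x.
    by move=> /negE xa y yx ya; apply/yx/xa => //; exact/set_mem/valP.
  move=> xa; apply/negE => p Pp pa; apply: contrapT => nxp.
  exact: (xa (set_point Pp)).
exists pairs_embed; split.
  split=> //; [exact: pairs_embed_inj|exact: pairs_embed_sup|].
  exact: pairs_embed_inf.
by move=> cL; split=> //; [exact: pairs_embed_bij|exact: pairs_embed_le].
Qed.

Lemma pair_rel_refl :
  (forall p, P p -> ~ p.1 <= p.2) -> RelationClasses.Reflexive R.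
Proof. by move=> nP x; apply/nP/set_mem/valP. Qed.

Lemma pre_refines_le (x y : set_type P) :
  (val x).1 <= (val y).1 -> pre_refines R x y.
Proof. by move=> xy z zx yz; apply: zx; exact: le_trans yz. Qed.

End PairRepresentation.

(** * Negations and the properties of the relation *)

Section Negations.
Context {d : Order.disp_t} {L : tbLatticeType d} (neg : L -> L).
Hypothesis anti : antitone neg.
Implicit Types P : set (L * L).

(** This is the chain [c <= neg a <= neg y.1 <= y.2]. *)
Lemma le_neg_pairs P (a c : L) : (forall p, P p -> neg p.1 <= p.2) ->
  c <= neg a -> forall y, P y -> y.1 <= a -> c <= y.2.
Proof.
move=> negP ca y Py ya; apply: le_trans ca _.
by apply: le_trans (negP _ Py); exact: anti.
Qed.

Hypothesis dneg : forall a, a <= neg (neg a).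

Lemma galois_neg (a b : L) : a <= neg b -> b <= neg a.
Proof. by move=> /anti; exact: le_trans. Qed.

Context (V : set L) (P : set (L * L)).
Hypotheses (dV : join_dense V)
  (VP : forall v, V v -> v <> \bot -> P (v, neg v)).

(** The goal is equivalent to [a <= neg c], which can be tested on the [v] in [V] below [a]; each
    [v <= neg c] turns back into [c <= neg v], the hypothesis at [(v, neg v)]. *)
Lemma pairs_le_neg (a c : L) :
  (forall y, P y -> y.1 <= a -> c <= y.2) -> c <= neg a.
Proof.
move=> Pac; apply: galois_neg; apply: (join_dense_le dV) => v Vv va.
have [->|/eqP v0] := eqVneq v \bot; first exact: le0x.
by apply: galois_neg; apply: Pac (VP Vv v0) va.
Qed.

Hypothesis negP : forall p, P p -> neg p.1 <= p.2.

Let R := @pair_rel d L P.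

Lemma pair_rel_neg (x : set_type P) v (Pv : P (v, neg v)) :
  ~ v <= (val x).2 -> R (set_point Pv) x.
Proof.
move=> nvx /galois_neg vx; apply: nvx; apply: le_trans vx _.
exact: negP (set_mem (valP x)).
Qed.

Lemma pair_rel_pseudosymmetric : pseudosymmetric R.
Proof.
move=> x y yx; have [v [Vv vx nvy]] := join_dense_nle dV yx.
have v0 : v <> \bot by move=> v0; apply: nvy; rewrite v0 le0x.
exists (set_point (VP Vv v0)); last exact: pre_refines_le.
exact: pair_rel_neg nvy.
Qed.

(** With [v = x.1] available, the witness has the same first component as [x], so each pre-refines
    the other. *)
Lemma pair_rel_strongly_pseudosymmetric :
  V = [set: L] -> strongly_pseudosymmetric R.
Proof.
move=> VT x y yx.
have x0 : (val x).1 <> \bot by move=> x0; apply: yx; rewrite x0 le0x.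
have Vx : V (val x).1 by rewrite VT.
exists (set_point (VP Vx x0)).
by split; [exact: pair_rel_neg yx|exact: pre_refines_le..].
Qed.

Lemma pair_rel_weakly_compossible :
  (forall p, P p -> ~ p.1 <= p.2) -> pseudocomplementation neg ->
  weakly_compossible R.
Proof.
move=> reflP pneg x y yx.
(* Were the meet zero, maximality of the pseudocomplement would give [x.1 <= neg y.1 <= y.2],
   against [yx]. *)
have nxy : ~ (Order.meet (val y).1 (val x).1 <= \bot).
  rewrite lex0 => /eqP/(pneg _).2 xy; apply: yx; apply: le_trans xy _.
  exact: negP (set_mem (valP y)).
have [v [Vv + nv0]] := join_dense_nle dV nxy.
rewrite lexI => /andP[vy vx].
have v0 : v <> \bot by move=> v0; apply: nv0; rewrite v0.
exists (set_point (VP Vv v0)); split; [|exact: pre_refines_le..].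
(* The witness precedes itself, so it is not absurd. *)
by apply; exists (set_point (VP Vv v0)); exact: pair_rel_refl.
Qed.

End Negations.

Theorem theorem4p24 (d : Order.disp_t) (L : tbLatticeType d)
    (V Lam : set L) (neg : L -> L) :
  join_dense V -> meet_dense Lam ->
  [/\ (* (1) *)
      precomplementation neg ->
      let P := [set (a, neg a) | a in [set: L]]
               `|` [set (\top%O, b) | b in Lam] in
      let R := @pair_rel d L P in
      exists f : L -> fixlat R,
        complete_embedding neg fixneg f /\
        (complete_lattice L -> lattice_isomorphism neg fixneg f),
      (* (2) *)
      protocomplementation neg ->
      let P := [set (a, neg a) | a in [set a : L | a <> \bot%O]]
               `|` [set (\top%O, b) | b in [set b | Lam b /\ b <> \top%O]] in
      let R := @pair_rel d L P in
      (exists f : L -> fixlat R,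
        complete_embedding neg fixneg f /\
        (complete_lattice L -> lattice_isomorphism neg fixneg f)) /\
      RelationClasses.Reflexive R,
      (* (3) *)
      ultraweak_pseudocomplementation neg ->
      let P := [set (a, neg a) | a in V] `|` [set (\top%O, b) | b in Lam] in
      let R := @pair_rel d L P in
      [/\ exists f : L -> fixlat R,
            complete_embedding neg fixneg f /\
            (complete_lattice L -> lattice_isomorphism neg fixneg f),
          pseudosymmetric R
        & V = [set: L] -> strongly_pseudosymmetric R]
    & (* (4) *)
      weak_pseudocomplementation neg ->
      let P := [set (a, neg a) | a in [set a | V a /\ a <> \bot%O]]
               `|` [set (\top%O, b) | b in [set b | Lam b /\ b <> \top%O]] in
      let R := @pair_rel d L P in
      [/\ exists f : L -> fixlat R,
            complete_embedding neg fixneg f /\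
            (complete_lattice L -> lattice_isomorphism neg fixneg f),
          RelationClasses.Reflexive R,
          pseudosymmetric R,
          V = [set: L] -> strongly_pseudosymmetric R
        & pseudocomplementation neg -> weakly_compossible R]].
Proof.
move=> dV dLam; split.
- move=> [anti neg1] P R; apply: pair_representation.
  + apply: (join_dense_sub join_denseT) => a _ _.
    by exists (a, neg a) => //; left; exists a.
  + apply: (meet_dense_sub dLam) => b Lb _.
    by exists (\top, b) => //; right; exists b.
  move=> a c; split=> [|Pac]; last first.
    (* Here [P] contains [(a, neg a)] for every [a], so this pair itself serves as the test. *)
    by apply: (Pac (a, neg a)) => //; left; exists a.
  by apply: le_neg_pairs => // _ [[b _ <-]|[b _ <-]] //=; rewrite neg1 le0x.
- move=> [anti negI neg0] P R.
  have neg1 : neg \top = \bot by rewrite -(negI \top) meet1x.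
  split; last first.
    apply: pair_rel_refl => _ [[a a0 <-]|[b [_ b1] <-]] /=.
      (* If [a <= neg a], then [a] equals its meet with [neg a], which is zero. *)
      by move=> /meet_idPl; rewrite negI => /esym.
    by rewrite le1x => /eqP.
  apply: pair_representation.
  + apply: (join_dense_sub join_denseT) => a _ a0.
    by exists (a, neg a) => //; left; exists a.
  + apply: (meet_dense_sub dLam) => b Lb b1.
    by exists (\top, b) => //; right; exists b.
  move=> a c; split=> [|Pac].
    by apply: le_neg_pairs => // _ [[b _ <-]|[b _ <-]] //=; rewrite neg1 le0x.
  (* The construction of [P] supplies a test pair only for nonzero [a]; at zero, [neg \bot = \top]
     settles the bound. *)
  have [->|/eqP a0] := eqVneq a \bot; first by rewrite neg0 lex1.
  by apply: (Pac (a, neg a)) => //; left; exists a.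
- move=> [anti dneg neg1] P R.
  have VP v : V v -> v <> \bot -> P (v, neg v).
    by move=> Vv _; left; exists v.
  have negP p : P p -> (neg p.1 <= p.2).
    by move=> [[a _ <-]|[b _ <-]] //=; rewrite neg1 le0x.
  split; [|exact: pair_rel_pseudosymmetric VP negP|].
    apply: pair_representation.
    + apply: (join_dense_sub dV) => v Vv v0.
      by exists (v, neg v) => //; exact: VP.
    + apply: (meet_dense_sub dLam) => b Lb _.
      by exists (\top, b) => //; right; exists b.
    by move=> a c; split; [exact: le_neg_pairs|exact: pairs_le_neg VP _ _].
  exact: pair_rel_strongly_pseudosymmetric VP negP.
- move=> [anti negI dneg] P R.
  have neg1 : neg \top = \bot by rewrite -(negI \top) meet1x.
  have VP v : V v -> v <> \bot -> P (v, neg v).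
    by move=> Vv v0; left; exists v.
  have negP p : P p -> (neg p.1 <= p.2).
    by move=> [[a _ <-]|[b _ <-]] //=; rewrite neg1 le0x.
  have reflP p : P p -> ~ (p.1 <= p.2).
    move=> [[a [_ a0] <-]|[b [_ b1] <-]] /=.
      by move=> /meet_idPl; rewrite negI => /esym.
    by rewrite le1x => /eqP.
  split; [|exact: pair_rel_refl|exact: pair_rel_pseudosymmetric VP negP
          |exact: pair_rel_strongly_pseudosymmetric VP negP
          |exact: pair_rel_weakly_compossible dV VP negP reflP].
  apply: pair_representation.
  + apply: (join_dense_sub dV) => v Vv v0.
    by exists (v, neg v) => //; exact: VP.
  + apply: (meet_dense_sub dLam) => b Lb b1.
    by exists (\top, b) => //; right; exists b.
  by move=> a c; split; [exact: le_neg_pairs|exact: pairs_le_neg VP _ _].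
Qed.
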